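(* Let $I\subseteq\mathbb{R}$ be a nonempty open interval and let $f:I\to\mathbb{R}$ be a function. (i) Let $n\in\mathbb{N}$ and denote $\omega_n:=\mathrm{e}^{\frac{2\pi}{n}\mathrm{i}}$. Let $\lambda_1,\dots,\lambda_n\in[0,1]$ be such that $\lambda_1+\dots+\lambda_n=1$ and $$\sum_{j=1}^n\lambda_j\omega_n^{k(j-1)}\neq0,\qquad k\in\{1,\dots,n-1\}.$$ If the inequality $$f\left(\frac{x_1+\cdots+x_n}{n}\right)\leq\frac{1}{n}\sum_{j=0}^{n-1}f(\lambda_{1\oplus j}x_1+\cdots+\lambda_{n\oplus j}x_n)$$ holds for all $x_1,\dots,x_n\in I$, then the function $f$ is Jensen convex on $I$. (ii) If the function $f$ is Jensen convex on $I$, then the inequality $$f\left(\frac{x_1+\cdots+x_n}{n}\right)\leq\frac{1}{n}\sum_{j=0}^{n-1}f(\lambda_{1\oplus j}x_1+\cdots+\lambda_{n\oplus j}x_n)$$ holds for all $n\in\mathbb{N}$, for all $\lambda_1,\dots,\lambda_n\in[0,1]$ with $\lambda_1+\dots+\lambda_n=1$ and for all $x_1,\dots,x_n\in I$.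
   Context: $\mathbb{N}$ denotes the set of positive integers, and $\mathrm{i}$ is the imaginary unit. For $n\in\mathbb{N}$, $i\in\{1,\dots,n\}$ and $j\in\{0,\dots,n-1\}$, the truncated sum $i\oplus j$ is defined by $i\oplus j:=i+j$ if $i+j\leq n$, and $i\oplus j:=i+j-n$ if $i+j>n$. A function $f:I\to\mathbb{R}$ is Jensen convex on $I$ if $f\left(\frac{x+y}{2}\right)\leq\frac{f(x)+f(y)}{2}$ for all $x,y\in I$.
   Formalization: Part (i) is proved for n ≥ 2 only: for n = 1 the condition on the weights is empty and the inequality reads f(x) ≤ f(x), so the claim fails, e.g. for f(x) = −x² on the real line. *)

(* Defs.v *)
From HB Require Import structures.
From mathcomp Require Import all_boot all_order all_algebra.
From mathcomp Require Import complex zify.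
From mathcomp Require Import all_classical all_reals all_analysis.
Set Implicit Arguments.
Unset Strict Implicit.
Unset Printing Implicit Defensive.
Import Order.TTheory GRing.Theory Num.Theory.
Local Open Scope ring_scope.

Definition jensen_convex (R : realType) (I : set R) (f : R -> R) : Prop :=
  forall x y : R, I x -> I y -> f ((x + y) / 2) <= (f x + f y) / 2.

Definition cexp (R : realType) (z : R[i]) : R[i] :=
  ((expR (complex.Re z))%:C * (cos (complex.Im z) +i* sin (complex.Im z)))%C.

Definition omega (R : realType) (n : nat) : R[i] :=
  cexp (0 +i* (2 * pi / n%:R))%C.

(* Truncated sum on 1-based indices, for 1 <= i <= n and 0 <= j <= n - 1. *)
Definition oplus (n i j : nat) : nat :=
  if (i + j <= n)%N then (i + j)%N else (i + j - n)%N.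

Lemma oplus_pred_lt (n : nat) (i j : 'I_n) : ((oplus n i.+1 j).-1 < n)%N.
Proof.
by case: i j => i lti [j ltj]; rewrite /oplus /=; case: ifP; lia.
Qed.

(* A family a_1, ..., a_n is encoded as a : 'I_n -> R with a_i at i - 1, so the
   1-based truncated sum is conjugated by the shift i |-> i.+1. *)
Definition ord_oplus (n : nat) (i j : 'I_n) : 'I_n :=
  Ordinal (oplus_pred_lt i j).

Definition convex_weights (R : realType) (n : nat) (lam : 'I_n -> R) : Prop :=
  (forall i, 0 <= lam i <= 1) /\ \sum_(i < n) lam i = 1.

Definition cyclic_ineq (R : realType) (I : set R) (f : R -> R) (n : nat)
    (lam : 'I_n -> R) : Prop :=
  forall x : 'I_n -> R, (forall i, I (x i)) ->
    f ((\sum_(i < n) x i) / n%:R) <=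
      n%:R^-1 * \sum_(j < n) f (\sum_(i < n) lam (ord_oplus i j) * x i).

(* For n = 1 the inequality reads f x <= f x and there is no condition on the
   discrete Fourier transform of lam, so this case carries no information on f
   and has to be excluded whenever convexity is deduced from cyclic_ineq. *)
Lemma cyclic_ineq1 (R : realType) (I : set R) (f : R -> R) (lam : 'I_1 -> R) :
  convex_weights lam -> cyclic_ineq I f lam.
Proof.
move=> [_]; rewrite big_ord1 => lam1 x _.
rewrite !big_ord1 invr1 mulr1 mul1r.
by rewrite [ord_oplus _ _]ord1 lam1 mul1r.
Qed.

(* Main.v *)
Require Import Defs.
From HB Require Import structures.
From mathcomp Require Import all_boot all_order all_algebra.
From mathcomp Require Import complex zify ring lra.
From mathcomp Require Import all_classical all_reals all_analysis.
Set Implicit Arguments.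
Unset Strict Implicit.
Unset Printing Implicit Defensive.
Import Order.TTheory GRing.Theory Num.Theory.
Import numFieldNormedType.Exports.
Local Open Scope classical_set_scope.
Local Open Scope ring_scope.

(** The points on the right-hand side of the cyclic inequality are the images
    of [x_1, ..., x_n] under a circulant matrix built from the weights. Its rows
    and columns sum to one ([sum_ord_oplus], [sum_circulant]), so these points
    are convex combinations of the [x_i] and have the same mean. Hence (ii) is
    Jensen's inequality for the mean of [n] points ([jensen_mean_ineq]), which
    follows from midpoint convexity by Cauchy's doubling argument.

    For (i), the discrete Fourier transform turns multiplication by the matrix
    into a pointwise product with the transform of the weights
    ([circulant_dft]). This transform is nonzero at every
    frequency [1 <= k <= n - 1] by hypothesis, and equals one at [k = 0], so the
    matrix is invertible ([circulant_unitmx]). One can therefore choose the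
    [x_i] so that the points on the right-hand side are [m - h], [m + h] and
    [n - 2] copies of [m], as long as [h] is small enough to keep the [x_i] in
    [I]; this gives the midpoint inequality for small steps
    ([cyclic_ineq_local]). A midpoint inequality for small steps holds for all
    steps, because its restriction to a fine subdivision of a segment is a
    discretely convex sequence ([jensen_convex_local]). *)

(** * The truncated sum as addition modulo [n] *)

Lemma ord_oplus_sym (n : nat) (i j : 'I_n) : ord_oplus i j = ord_oplus j i.
Proof. by apply: val_inj; rewrite /= /oplus; do 2!case: ifP; lia. Qed.

Lemma ord_oplus_inj (n : nat) (i : 'I_n) : injective (ord_oplus i).
Proof.
move=> j k /(congr1 val) /=; rewrite /oplus => jk; apply: val_inj => /=.
have := ltn_ord i; have := ltn_ord j; have := ltn_ord k.
by move: jk => /=; do 2!case: ifP; lia.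
Qed.

Lemma sum_ord_oplus (V : nmodType) (n : nat) (F : 'I_n -> V) (i : 'I_n) :
  \sum_j F (ord_oplus i j) = \sum_j F j.
Proof.
rewrite [RHS](reindex (ord_oplus i)) //.
exact/onW_bij/injF_bij/ord_oplus_inj.
Qed.

Lemma expr_ord_oplus (A : nzRingType) (n : nat) (z : A) (i j : 'I_n) :
  z ^+ n = 1 -> z ^+ ord_oplus i j = z ^+ (i + j).
Proof.
move=> zn1; have := ltn_ord i; have := ltn_ord j.
rewrite /= /oplus addSn; case: ifP => //= /negbT; rewrite -ltnNge => ijn _ _.
rewrite -[in RHS](@subnK n (i + j)%N); last by lia.
by rewrite exprD zn1 mulr1; congr (_ ^+ _); lia.
Qed.

(** * Circulant matrices and their Fourier transform *)

(** Since [ord_oplus i j] adds its arguments modulo [n], this is the symmetric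
    form of a circulant matrix: its rows shift to the left. *)
Definition circulant (F : fieldType) (n : nat) (lam : 'I_n -> F) : 'M[F]_n :=
  \matrix_(i, j) lam (ord_oplus i j).

(** Multiplying by the matrix is a cyclic correlation, which the Fourier
    transform at a root of unity [z] turns into a product; the correlation, as
    opposed to a convolution, is what puts [z^-1] in the factor of [x]. *)
Lemma circulant_dft (F : fieldType) (n : nat) (lam : 'I_n -> F) (z : F)
    (x : 'rV[F]_n) : z ^+ n = 1 ->
  \sum_j (x *m circulant lam) 0 j * z ^+ j =
  (\sum_j lam j * z ^+ j) * (\sum_i x 0 i * z^-1 ^+ i).
Proof.
move=> zn1.
under eq_bigr do rewrite mxE big_distrl /=.
rewrite exchange_big big_distrr /=; apply: eq_bigr => i _.
have z_neq0 : z ^+ i != 0.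
  have n_gt0 : (0 < n)%N by apply: leq_ltn_trans (ltn_ord i).
  rewrite expf_neq0 //; apply/eqP => z0; move: zn1.
  by rewrite z0 expr0n gtn_eqF // => /eqP; rewrite eq_sym oner_eq0.
rewrite -[in RHS](sum_ord_oplus _ i) big_distrl /=; apply: eq_bigr => j _.
by rewrite mxE expr_ord_oplus // exprD exprVn; field.
Qed.

(** A vector [x] in the kernel has a vanishing transform, because the transform
    of [lam] has no zero. The polynomial with coefficients [x] thus has the [n]
    powers of [w^-1] as distinct roots, and its degree is less than [n]. *)
Lemma circulant_unitmx (F : fieldType) (n : nat) (lam : 'I_n -> F) (w : F) :
  n.-primitive_root w ->
  (forall k, (k < n)%N -> \sum_j lam j * w ^+ (k * j) != 0) ->
  circulant lam \in unitmx.
Proof.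
move=> w_prim dft_neq0; rewrite -row_free_unit; apply: inj_row_free => x xA0.
pose p := \poly_(i < n) (if insub i is Some i' then x 0 i' else 0).
have p_coef (i : 'I_n) : p`_i = x 0 i by rewrite coef_poly ltn_ord valK.
suff p0 : p = 0 by apply/rowP => i; rewrite -p_coef p0 coef0 mxE.
apply: (@roots_geq_poly_eq0 _ _ [seq w^-1 ^+ k | k <- iota 0 n]).
- apply/allP => z /mapP[k + ->]; rewrite mem_iota add0n /= => k_lt.
  have wk1 : (w ^+ k) ^+ n = 1.
    by rewrite exprAC (prim_expr_order w_prim) expr1n.
  have /eqP := circulant_dft lam x wk1.
  rewrite xA0 big1 => [|j _]; last by rewrite mxE mul0r.
  under eq_bigr do rewrite -exprM.
  rewrite eq_sym mulf_eq0 (negbTE (dft_neq0 k k_lt)) /= exprVn => /eqP px0.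
  apply/eqP; rewrite horner_poly -[RHS]px0; apply: eq_bigr => i _.
  by rewrite valK.
- rewrite map_inj_in_uniq ?iota_uniq // => k l.
  rewrite !mem_iota /= !add0n => k_lt l_lt; rewrite !exprVn => /invr_inj/eqP.
  by rewrite (eq_prim_root_expr w_prim) !modn_small // => /eqP.
- by rewrite size_map size_iota size_poly.
Qed.

(** The entries of [lam] also fill each column of the matrix, so that averaging
    the arguments on the right-hand side of the cyclic inequality gives the
    argument on its left-hand side. *)
Lemma sum_circulant (A : nzRingType) (n : nat) (lam x : 'I_n -> A) :
  \sum_j lam j = 1 ->
  \sum_j \sum_i lam (ord_oplus i j) * x i = \sum_i x i.
Proof.
move=> lam1; rewrite exchange_big; apply: eq_bigr => i _ /=.
by rewrite -big_distrl /= sum_ord_oplus lam1 mul1r.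
Qed.

(** * The complex root of unity *)

(** De Moivre's formula. *)
Lemma omegaX (R : realType) (n k : nat) :
  omega R n ^+ k =
  (cos (k%:R * (2 * pi / n%:R)) +i* sin (k%:R * (2 * pi / n%:R)))%C.
Proof.
rewrite /omega /cexp /= expR0 mul1r; set t := 2 * pi / _.
elim: k => [|k IH]; first by rewrite expr0 mul0r cos0 sin0.
rewrite exprSr IH -natr1 mulrDl mul1r cosD sinD.
by apply/eqP; rewrite eq_complex /= eqxx addrC eqxx.
Qed.

Lemma cos_neq1 (R : realType) (t : R) : 0 < t < 2 * pi -> cos t != 1.
Proof.
move=> /andP[t_gt0 t_lt]; have -> : t = (t / 2) *+ 2.
  by rewrite mulr2n -splitr.
rewrite cos_mulr2n cos2sin2; apply/eqP => sin0.
have : 0 < sin (t / 2) ^+ 2 by rewrite exprn_gt0 // sin_gt0_pi //; lra.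
lra.
Qed.

Lemma omega_prim (R : realType) (n : nat) : (0 < n)%N ->
  n.-primitive_root (omega R n).
Proof.
move=> n_gt0; have nR : 0 < n%:R :> R by rewrite ltr0n.
apply/andP; split=> //; apply/forallP => i; rewrite unity_rootE omegaX.
have [->|i_neq] := eqVneq i.+1 n.
  rewrite mulrC divfK ?(gt_eqF nR) // mulr_natl cos2pi sin2pi.
  by rewrite !eqxx.
rewrite eqbF_neg eq_complex /= negb_and cos_neq1 //.
have i_lt : (i.+1 < n)%N by rewrite ltn_neqAle i_neq ltn_ord.
have t_gt0 : 0 < 2 * pi / n%:R :> R by rewrite divr_gt0 // mulr_gt0 // pi_gt0.
rewrite mulr_gt0 ?ltr0n //= mulrCA gtr_pMr ?mulr_gt0 ?pi_gt0 //.
by rewrite ltr_pdivrMr // mul1r ltr_nat.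
Qed.

(** * From Jensen convexity to the inequality for means of [n] points *)

Lemma interval_weighted_mean (R : realType) (I : set R) (n : nat)
    (lam x : 'I_n -> R) : is_interval I ->
  (forall i, 0 <= lam i) -> \sum_i lam i = 1 -> (forall i, I (x i)) ->
  I (\sum_i lam i * x i).
Proof.
case: n lam x => [|n] lam x I_itv lam_ge0 lam1 Ix.
  (* Weights that sum to one exclude the empty family. *)
  by move: lam1 => /eqP; rewrite big_ord0 eq_sym oner_eq0.
case: (arg_minP x (i0 := ord0) (P := xpredT) isT) => a _ a_min.
case: (arg_maxP x (i0 := ord0) (P := xpredT) isT) => b _ b_max.
apply: (I_itv (x a) (x b)) => //.
rewrite -[x a]mul1r -[x b]mul1r -lam1 !big_distrl /=.
apply/andP; split; apply: ler_sum => i _; rewrite ler_wpM2l //.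
- exact: a_min.
- exact: b_max.
Qed.

Lemma interval_mean (R : realType) (I : set R) (n : nat) (x : 'I_n -> R) :
  is_interval I -> (0 < n)%N -> (forall i, I (x i)) -> I ((\sum_i x i) / n%:R).
Proof.
move=> I_itv n_gt0 Ix; rewrite mulrC big_distrr /=.
apply: interval_weighted_mean => //.
by rewrite sumr_const card_ord -[_^-1 *+ _]mulr_natr mulVf // pnatr_eq0 -lt0n.
Qed.

Definition mean_ineq (R : realType) (I : set R) (f : R -> R) (n : nat) : Prop :=
  forall x : 'I_n -> R, (forall i, I (x i)) ->
    n%:R * f ((\sum_i x i) / n%:R) <= \sum_i f (x i).

(** A mean of [n + n] points is the midpoint of two means of [n] points. *)
Lemma mean_ineq_double (R : realType) (I : set R) (f : R -> R) (n : nat) :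
  is_interval I -> jensen_convex I f -> (0 < n)%N ->
  mean_ineq I f n -> mean_ineq I f (n + n).
Proof.
move=> I_itv f_cvx n_gt0 f_n x Ix; rewrite !big_split_ord /=.
set xl := fun i => x (lshift n i); set xr := fun i => x (rshift n i).
have n_neq0 : n%:R != 0 :> R by rewrite pnatr_eq0 -lt0n.
have -> : (\sum_i xl i + \sum_i xr i) / (n + n)%:R =
    ((\sum_i xl i) / n%:R + (\sum_i xr i) / n%:R) / 2.
  by rewrite natrD; field; rewrite n_neq0 -mulr2n mulrn_eq0 negb_or n_neq0.
apply: le_trans (lerD (f_n xl (fun i => Ix _)) (f_n xr (fun i => Ix _))).
rewrite natrD mulrDl -!mulrDr ler_wpM2l // -mulr2n -[f _ *+ 2]mulr_natr.
rewrite -ler_pdivlMr //.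
by apply: f_cvx; apply: interval_mean => // i; exact: Ix.
Qed.

(** Adding [r] copies of the mean [m] of the [n] given points leaves the mean
    unchanged and adds [r * f m] to both sides of the inequality. *)
Lemma mean_ineq_pad (R : realType) (I : set R) (f : R -> R) (n r : nat) :
  is_interval I -> (0 < n)%N -> mean_ineq I f (n + r) -> mean_ineq I f n.
Proof.
move=> I_itv n_gt0 f_nr x Ix; set m := _ / _.
have Im : I m by exact: interval_mean.
have n_neq0 : n%:R != 0 :> R by rewrite pnatr_eq0 -lt0n.
have nm : n%:R * m = \sum_i x i by rewrite mulrC divfK.
pose y (k : 'I_(n + r)) := if fintype.split k is inl i then x i else m.
have yl i : y (lshift r i) = x i by rewrite /y (unsplitK (inl i)).
have yr i : y (rshift n i) = m by rewrite /y (unsplitK (inr i)).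
have Iy k : I (y k) by rewrite /y; case: fintype.split.
have := f_nr y Iy; rewrite !big_split_ord /=.
under eq_bigr do rewrite yl.
under [X in _ + X]eq_bigr do rewrite yr.
under [X in _ <= X + _]eq_bigr do rewrite yl.
under [X in _ <= _ + X]eq_bigr do rewrite yr.
rewrite !sumr_const card_ord -nm -[m *+ r]mulr_natl -[f m *+ r]mulr_natl.
rewrite -mulrDl -natrD.
have nr_neq0 : (n + r)%:R != 0 :> R.
  by rewrite pnatr_eq0 addn_eq0 negb_and -lt0n n_gt0.
by rewrite mulrAC divff // mul1r natrD mulrDl lerD2r.
Qed.

(** Cauchy's argument: doubling reaches the powers of two, and padding brings
    [2 ^ n >= n] points back to [n]. *)
Lemma jensen_mean_ineq (R : realType) (I : set R) (f : R -> R) (n : nat) :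
  is_interval I -> jensen_convex I f -> (0 < n)%N -> mean_ineq I f n.
Proof.
move=> I_itv f_cvx n_gt0.
have f_pow2 k : mean_ineq I f (2 ^ k).
  elim: k => [|k IH]; first by move=> x _; rewrite !big_ord1 mul1r divr1.
  by rewrite expnS mul2n -addnn; apply: mean_ineq_double; rewrite ?expn_gt0.
apply: (@mean_ineq_pad _ _ _ _ (2 ^ n - n)) => //.
by rewrite subnKC ?(ltnW (ltn_expl _ _)).
Qed.

(** * From the cyclic inequality to Jensen convexity *)

(** Inverting the matrix, any small perturbation of the constant family [m] can
    be prescribed for the arguments on the right-hand side of the cyclic
    inequality. Prescribing [m - h], [m + h] and otherwise [m], the terms [f m]
    cancel and the midpoint inequality remains. The constant [K] bounds how far
    the points [x i] lie from [m]; it depends on [lam] only, which is what makes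
    the local inequality uniform. *)
Lemma cyclic_ineq_local (R : realType) (I : set R) (f : R -> R) (n : nat)
    (lam : 'I_n -> R) : (2 <= n)%N -> \sum_i lam i = 1 ->
  circulant lam \in unitmx -> cyclic_ineq I f lam ->
  exists2 K, 0 <= K & forall m h,
    (forall t, `|t| <= K * `|h| -> I (m + t)) ->
    2 * f m <= f (m - h) + f (m + h).
Proof.
case: n lam => [//|[//|n]] lam _ lam1 A_unit f_cyc.
set N := n.+2 in lam lam1 A_unit f_cyc *.
(* [h *: d] is the perturbation of the constant family [m]. *)
pose d : 'rV[R]_N := delta_mx 0 ord_max - delta_mx 0 ord0.
pose c := d *m invmx (circulant lam).
exists (\sum_i `|c 0 i|) => [|m h I_near]; first exact: sumr_ge0.
pose x i := m + h * c 0 i.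
have Ix i : I (x i).
  apply: I_near; rewrite normrM mulrC ler_wpM2r // (bigD1 i) //= lerDl.
  exact: sumr_ge0.
have y_def j : \sum_i lam (ord_oplus i j) * x i = m + h * d 0 j.
  under eq_bigr do rewrite mulrDr mulrCA.
  rewrite big_split /= -big_distrl -big_distrr /=.
  under eq_bigr do rewrite ord_oplus_sym.
  rewrite sum_ord_oplus lam1 mul1r -[d in RHS](mulmxKV A_unit) [in RHS]mxE.
  congr (_ + h * _); apply: eq_bigr => i _.
  by rewrite mulrC [circulant _ _ _]mxE.
have N_gt0 : 0 < N%:R :> R by rewrite ltr0n.
have sum_delta (k : 'I_N) : \sum_j (delta_mx 0 k : 'rV[R]_N) 0 j = 1.
  rewrite (bigD1 k) //= mxE !eqxx big1 ?addr0 // => j /negbTE jk.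
  by rewrite mxE jk andbF.
have sum_d : \sum_j d 0 j = 0.
  rewrite -[RHS](subrr 1) -[X in X - _](sum_delta ord_max) -(sum_delta ord0).
  by rewrite -sumrB; apply: eq_bigr => j _; rewrite /d !mxE.
have mean_x : (\sum_i x i) / N%:R = m.
  rewrite -(sum_circulant x lam1); under eq_bigr do rewrite y_def.
  rewrite big_split /= -big_distrr /=.
  rewrite sum_d mulr0 addr0 sumr_const card_ord.
  by rewrite -[m *+ _]mulr_natr mulfK ?gt_eqF.
have := f_cyc x Ix; rewrite mean_x mulrC ler_pdivlMr //.
under eq_bigr do rewrite y_def.
rewrite (bigD1 ord0) // (bigD1 ord_max) //=.
rewrite (eq_bigr (fun=> f m)) => [|j /andP[/negbTE j0 /negbTE j1]]; last first.
  by rewrite !mxE j0 j1 /= subrr mulr0 addr0.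
rewrite sumr_const !mxE /= !eqxx /= sub0r subr0 mulr1 mulrN1.
have -> : #|[pred j : 'I_N | (j != ord0) && (j != ord_max)]| = n.
  have := cardC (pred2 (@ord0 n.+1) ord_max).
  rewrite card2 card_ord /= => -[] eqn.
  by rewrite -[RHS]eqn; apply: eq_card => j; rewrite !inE negb_or.
by rewrite -[f m *+ n]mulr_natr /N -!natr1; lra.
Qed.

(** The increments of [a] are nondecreasing, so the first [M] of them have a sum
    at most that of the last [M]. *)
Lemma discrete_convex_midpoint (R : realFieldType) (a : nat -> R) (M : nat) :
  (forall i, (0 < i < M + M)%N -> 2 * a i <= a i.-1 + a i.+1) ->
  2 * a M <= a 0%N + a (M + M)%N.
Proof.
move=> a_cvx; pose d i := a i.+1 - a i.
have d_mono i k : (i + k < M + M)%N -> d i <= d (i + k)%N.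
  elim: k => [|k IH] ik; first by rewrite addn0.
  apply: le_trans (IH _) _; first by lia.
  by rewrite addnS in ik *; have := a_cvx (i + k).+1 ik; rewrite /d /=; lra.
have dl : \sum_(i < M) d i = a M - a 0%N.
  by rewrite -(big_mkord xpredT d) /d telescope_sumr.
have dr : \sum_(i < M) d (i + M)%N = a (M + M)%N - a M.
  by rewrite -(big_mkord xpredT (fun i => d (i + M)%N)) /d telescope_sumr.
have : \sum_(i < M) d i <= \sum_(i < M) d (i + M)%N.
  by apply: ler_sum => i _; apply: d_mono; have := ltn_ord i; lia.
rewrite dl dr; lra.
Qed.

(** Cutting the segment from [x] to [y] into [M + M] equal steps [h], the local
    inequality applies at each interior node once [K * `|h|] is below a radius
    [e] for which [I] contains the balls around [x] and [y]. The values of [f]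
    at the nodes are then a discretely convex sequence with middle term
    [f ((x + y) / 2)]. *)
Lemma jensen_convex_local (R : realType) (I : set R) (f : R -> R) (K : R) :
  open I -> is_interval I -> 0 <= K ->
  (forall m h, (forall t, `|t| <= K * `|h| -> I (m + t)) ->
     2 * f m <= f (m - h) + f (m + h)) ->
  jensen_convex I f.
Proof.
move=> I_open I_itv K_ge0 f_loc x y Ix Iy.
have near z : I z -> exists2 e, 0 < e & forall t, `|t| < e -> I (z + t).
  move=> Iz; have : nbhs z I by exact: open_nbhs_nbhs.
  move=> /nbhs_ballP[e /= e_gt0 ze].
  exists e => // t te; apply: ze; rewrite /ball /=.
  by rewrite opprD addrA subrr sub0r normrN.
have [ex ex_gt0 Ixe] := near x Ix; have [ey ey_gt0 Iye] := near y Iy.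
pose e := Num.min ex ey; have e_gt0 : 0 < e by rewrite lt_min ex_gt0.
have s_ge0 : 0 <= K * `|y - x| / e by rewrite divr_ge0 ?mulr_ge0 // ltW.
pose M := (Num.bound (K * `|y - x| / e)).+1.
have M_gt0 : 0 < M%:R :> R by rewrite ltr0n.
pose h := (y - x) / (M + M)%:R.
have MM_gt0 : 0 < (M + M)%:R :> R by rewrite ltr0n.
have Mh : (M + M)%:R * h = y - x by rewrite mulrC divfK // gt_eqF.
have Kh : K * `|h| < e.
  have : K * `|y - x| < M%:R * e.
    rewrite -ltr_pdivrMr //; apply: lt_le_trans (archi_boundP s_ge0) _.
    by rewrite ler_nat.
  rewrite -Mh normrM (gtr0_norm MM_gt0) natrD => lt_e.
  have Kh_ge0 : 0 <= K * `|h| by rewrite mulr_ge0.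
  rewrite -(ltr_pM2l M_gt0); apply: le_lt_trans lt_e.
  have := mulr_ge0 (ltW M_gt0) Kh_ge0; lra.
pose a i := f (x + i%:R * h).
have aM : a M = f ((x + y) / 2).
  by congr f; move: Mh; rewrite natrD; lra.
have a0 : a 0%N = f x by rewrite /a mul0r addr0.
have aMM : a (M + M)%N = f y by rewrite /a Mh addrC subrK.
suff : 2 * a M <= a 0%N + a (M + M)%N by rewrite aM a0 aMM; lra.
apply: discrete_convex_midpoint => -[//|i] /andP[_ i_lt] /=.
have -> : a i = f (x + i.+1%:R * h - h) by congr f; rewrite -natr1; ring.
have -> : a i.+2 = f (x + i.+1%:R * h + h).
  by congr f; rewrite -[i.+2%:R]natr1; ring.
apply: f_loc => t t_le.
have /Ixe Ixt : `|t| < ex.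
  by apply: le_lt_trans t_le (lt_le_trans Kh _); rewrite ge_min lexx.
have /Iye Iyt : `|t| < ey.
  by apply: le_lt_trans t_le (lt_le_trans Kh _); rewrite ge_min lexx orbT.
(* Translating by [t] keeps the node between the translated endpoints. *)
have i_le : i.+1%:R <= (M + M)%:R :> R by rewrite ler_nat ltnW.
have i_ge : 0 <= i.+1%:R :> R by [].
have [h_ge0|h_lt0] := leP 0 h.
- apply: (I_itv (x + t) (y + t)) => //.
  have := ler_wpM2r h_ge0 i_le; have := mulr_ge0 i_ge h_ge0; rewrite Mh; lra.
- apply: (I_itv (y + t) (x + t)) => //.
  have := ler_wnM2r (ltW h_lt0) i_le; have := mulr_ge0_le0 i_ge (ltW h_lt0).
  rewrite Mh; lra.
Qed.

Theorem proposition3p1 (R : realType) (I : set R) (f : R -> R)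
    (I_neq0 : I !=set0) (I_open : open I) (I_itv : is_interval I) :
  (forall (n : nat) (lam : 'I_n -> R),
      (2 <= n)%N ->
      convex_weights lam ->
      (forall k : nat, (1 <= k <= n - 1)%N ->
         \sum_(j < n) (lam j)%:C%C * omega R n ^+ (k * j) != 0) ->
      cyclic_ineq I f lam ->
      jensen_convex I f)
  /\
  (jensen_convex I f ->
    forall (n : nat) (lam : 'I_n -> R),
      (1 <= n)%N ->
      convex_weights lam ->
      cyclic_ineq I f lam).
Proof.
split=> [n lam n_ge2 [_ lam1] dft_neq0 f_cyc|
         f_cvx n lam n_gt0 [lam01 lam1] x Ix].
  have n_gt0 : (0 < n)%N by exact: ltnW.
  have A_unit : circulant lam \in unitmx.
    rewrite -(map_unitmx (real_complex R)).
    have -> : map_mx (real_complex R) (circulant lam) =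
        circulant (fun i => (lam i)%:C%C) by apply/matrixP => i j; rewrite !mxE.
    (* The hypothesis omits the frequency 0, where the transform is the sum of
       the weights. *)
    apply: circulant_unitmx (omega_prim R n_gt0) _ => -[_|k k_lt].
      under eq_bigr do rewrite mul0n expr0 mulr1.
      by rewrite -(raddf_sum (real_complex R)) lam1 /= oner_neq0.
    by apply: dft_neq0; lia.
  have [K K_ge0 f_loc] := cyclic_ineq_local n_ge2 lam1 A_unit f_cyc.
  exact: jensen_convex_local f_loc.
rewrite [leRHS]mulrC ler_pdivlMr ?ltr0n // [leLHS]mulrC -(sum_circulant x lam1).
apply: (jensen_mean_ineq I_itv f_cvx n_gt0) => j.
apply: interval_weighted_mean => // [i|].
  by have /andP[] := lam01 (ord_oplus i j).
by under eq_bigr do rewrite ord_oplus_sym; rewrite sum_ord_oplus.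
Qed.
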